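(* For all $x,y\in\kappa$ one has $T_x\star T_y=T_y\star T_x$ in the Hecke algebra $\mathcal{H}_{K_\epsilon}(G_\epsilon)$.
   Context: $F$ is a non-Archimedean local field of characteristic different from $2$, $\mathcal{O}$ its ring of integers, $\varpi$ a generator of the maximal ideal, $\kappa=\mathcal{O}/\varpi\mathcal{O}$, $q=|\kappa|$. For a ring $A$, $A_\epsilon:=A[\epsilon]/(\epsilon^2)$. $G_\epsilon=\mathrm{PGL}_2(F_\epsilon)$, $K_\epsilon=\mathrm{PGL}_2(\mathcal{O}_\epsilon)$; elements of $\mathrm{PGL}_2$ are written as matrices in $\mathrm{GL}_2$. $\mathcal{H}_{K_\epsilon}(G_\epsilon)$ is the Hecke algebra of compactly supported $K_\epsilon$-biinvariant measures on $G_\epsilon$ (equivalently functions, via the Haar measure giving $K_\epsilon$ volume $1$), with convolution $\star$. For $x\in\kappa$ with a lift $\tilde x\in\mathcal{O}$, let $g_x=\begin{pmatrix}\varpi+\epsilon\tilde x&0\\0&1\end{pmatrix}$; the double coset $K_\epsilon g_xK_\epsilon$ does not depend on the lift. $T_x:=q^{-1}\,\mathrm{ch}_{K_\epsilon g_xK_\epsilon}$, where $\mathrm{ch}_S$ denotes the characteristic measure (function) of $S$. *)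

(* Defs.v *)
From HB Require Import structures.
From mathcomp Require Import all_boot all_order all_algebra.
From mathcomp Require Import qpoly ring_quotient generic_quotient finmap.
From mathcomp Require Import all_classical all_reals all_analysis.
From mathcomp Require Import complex.

Set Implicit Arguments.
Unset Strict Implicit.
Unset Printing Implicit Defensive.

Import Order.TTheory GRing.Theory Num.Theory.

Local Open Scope classical_set_scope.
Local Open Scope ring_scope.
Local Open Scope quotient_scope.

(* The value [dval 0] is irrelevant (conventionally it is +oo); [dval_ge]
   below is the total relation "v x >= n". *)
HB.mixin Record isDiscretelyValued F of GRing.Field F := {
  dval : F -> int;
  dvalM : forall x y : F, x != 0 -> y != 0 -> dval (x * y) = dval x + dval y;
  dvalD : forall x y : F, x != 0 -> y != 0 -> x + y != 0 ->
    Num.min (dval x) (dval y) <= dval (x + y);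
  dval_surj : exists2 x : F, x != 0 & dval x = 1
}.

#[short(type="discValFieldType")]
HB.structure Definition DiscValField :=
  { F of GRing.Field F & isDiscretelyValued F }.

Arguments dvalM {_ _ _}.
Arguments dvalD {_ _ _}.

Definition dval_ge (F : discValFieldType) (n : int) (x : F) : bool :=
  (x == 0) || (n <= dval x).

Section DvalTheory.
Variable F : discValFieldType.
Implicit Types (x y : F) (n m : int).

Lemma dval_ge0 n : dval_ge n (0 : F). Proof. by rewrite /dval_ge eqxx. Qed.

Lemma dval_le_trans m n x : m <= n -> dval_ge n x -> dval_ge m x.
Proof.
by move=> mn; rewrite /dval_ge; case: eqP => //= _; exact: le_trans.
Qed.

Lemma dval1 : dval (1 : F) = 0.
Proof.
have := dvalM (oner_neq0 F) (oner_neq0 F).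
by rewrite mulr1 => /eqP; rewrite -subr_eq0 opprD addNKr oppr_eq0 => /eqP.
Qed.

Lemma dvalN1 : dval (-1 : F) = 0.
Proof.
have N1 : (-1 : F) != 0 by rewrite oppr_eq0 oner_neq0.
have /esym/eqP := dvalM N1 N1; rewrite mulrNN mulr1 dval1 -mulr2n.
by rewrite mulrn_eq0 => /= /eqP.
Qed.

Lemma dvalN x : dval (- x) = dval x.
Proof.
have [->|x0] := eqVneq x 0; first by rewrite oppr0.
by rewrite -mulN1r dvalM ?oppr_eq0 ?oner_neq0// dvalN1 add0r.
Qed.

Lemma dval_geN n x : dval_ge n (- x) = dval_ge n x.
Proof. by rewrite /dval_ge oppr_eq0 dvalN. Qed.

Lemma dval_geD n x y : dval_ge n x -> dval_ge n y -> dval_ge n (x + y).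
Proof.
rewrite /dval_ge; have [->|x0] := eqVneq x 0; first by rewrite add0r.
have [->|y0] := eqVneq y 0; first by move=> + _; rewrite addr0 (negbTE x0).
have [//|xy0 /= nx ny] := eqVneq (x + y) 0.
by apply: le_trans (dvalD x0 y0 xy0); rewrite le_min nx.
Qed.

Lemma dval_geM m n x y :
  dval_ge m x -> dval_ge n y -> dval_ge (m + n) (x * y).
Proof.
rewrite /dval_ge; have [->|x0] := eqVneq x 0; first by rewrite mul0r eqxx.
have [->|y0] := eqVneq y 0; first by rewrite mulr0 eqxx.
by move=> /= mx ny; rewrite dvalM// lerD// orbT.
Qed.

End DvalTheory.

Definition dval_int (F : discValFieldType) : {pred F} := [pred x | dval_ge 0 x].

Fact dval_int_subring (F : discValFieldType) : subring_closed (@dval_int F).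
Proof.
split=> [|x y|x y]; rewrite !inE.
- by rewrite /dval_ge dval1 lexx orbT.
- by move=> ox oy; rewrite dval_geD// dval_geN.
- by move=> ox oy; rewrite -[0]addr0 dval_geM.
Qed.
HB.instance Definition _ (F : discValFieldType) :=
  GRing.isSubringClosed.Build F (@dval_int F) (@dval_int_subring F).

Record int_ring (F : discValFieldType) :=
  IntRing { int_ring_val :> F; _ : int_ring_val \in @dval_int F }.
HB.instance Definition _ (F : discValFieldType) :=
  [isSub for @int_ring_val F].
HB.instance Definition _ (F : discValFieldType) :=
  [Choice of int_ring F by <:].
HB.instance Definition _ (F : discValFieldType) :=
  [SubChoice_isSubComNzRing of int_ring F by <:].

Definition max_ideal (F : discValFieldType) : {pred (int_ring F)} :=
  [pred x : int_ring F | dval_ge 1 (x : F)].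

Fact max_ideal_idealr (F : discValFieldType) : idealr_closed (@max_ideal F).
Proof.
split; rewrite ?inE /=.
- exact: dval_ge0.
- by rewrite /dval_ge /= dval1 oner_eq0.
- move=> a u v; rewrite !inE /= => mu mv; apply: dval_geD => //.
  by rewrite -[1]add0r; apply: dval_geM => //; exact: (valP a).
Qed.
HB.instance Definition _ (F : discValFieldType) :=
  isIdealr.Build (int_ring F) (@max_ideal F) (@max_ideal_idealr F).

Definition residue_field (F : discValFieldType) : Type :=
  {ideal_quot (@max_ideal F)}.
HB.instance Definition _ (F : discValFieldType) :=
  GRing.ComNzRing.on (residue_field F).
HB.instance Definition _ (F : discValFieldType) :=
  Quotient.on (residue_field F).

HB.mixin Record isNonArchLocal F of DiscValField F := {
  dval_complete : forall u : nat -> F,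
    (forall n : int, exists N : nat, forall i j : nat,
       (N <= i)%N -> (N <= j)%N -> dval_ge n (u i - u j)) ->
    exists l : F, forall n : int, exists N : nat, forall i : nat,
      (N <= i)%N -> dval_ge n (u i - l);
  residue_finite : finite_set [set: residue_field F]
}.

#[short(type="nonArchLocalFieldType")]
HB.structure Definition NonArchLocalField :=
  { F of DiscValField F & isNonArchLocal F }.

Definition residue_card (F : nonArchLocalFieldType) : nat :=
  #|` fset_set [set: residue_field F]|%fset.

Definition generates_max_ideal (F : discValFieldType) (pi : int_ring F) :=
  forall a : int_ring F, a \in @max_ideal F <-> exists b : int_ring F, a = pi * b.

Record GL2 (R : comUnitRingType) :=
  MkGL2 { gl2_mx :> 'M[R]_2; gl2_unit : gl2_mx \in unitmx }.
HB.instance Definition _ (R : comUnitRingType) := [isSub for @gl2_mx R].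
HB.instance Definition _ (R : comUnitRingType) := [Choice of GL2 R by <:].

Section GL2Group.
Variable R : comUnitRingType.

Fact gl2_mul_unit (g h : GL2 R) : gl2_mx g *m gl2_mx h \in unitmx.
Proof. by rewrite unitmx_mul !gl2_unit. Qed.
Fact gl2_inv_unit (g : GL2 R) : invmx (gl2_mx g) \in unitmx.
Proof. by rewrite unitmx_inv gl2_unit. Qed.

Definition gl2_one : GL2 R := MkGL2 (unitmx1 R 2).
Definition gl2_mul (g h : GL2 R) : GL2 R := MkGL2 (gl2_mul_unit g h).
Definition gl2_inv (g : GL2 R) : GL2 R := MkGL2 (gl2_inv_unit g).

Fact gl2_mulA : associative gl2_mul.
Proof. by move=> g h k; apply: val_inj; exact: mulmxA. Qed.
Fact gl2_mul1 : left_id gl2_one gl2_mul.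
Proof. by move=> g; apply: val_inj; exact: mul1mx. Qed.
Fact gl2_mulr1 : right_id gl2_one gl2_mul.
Proof. by move=> g; apply: val_inj; exact: mulmx1. Qed.
Fact gl2_mulV : left_inverse gl2_one gl2_inv gl2_mul.
Proof. by move=> g; apply: val_inj; apply: mulVmx; exact: gl2_unit. Qed.
Fact gl2_mulrV : right_inverse gl2_one gl2_inv gl2_mul.
Proof. by move=> g; apply: val_inj; apply: mulmxV; exact: gl2_unit. Qed.

HB.instance Definition _ :=
  isGroup.Build (GL2 R) gl2_mulA gl2_mul1 gl2_mulr1 gl2_mulV gl2_mulrV.

Definition scalar_equiv (g h : GL2 R) : bool :=
  `[< exists2 c : R, c \is a GRing.unit & gl2_mx g = c *: gl2_mx h >].

Fact scalar_equiv_class : equiv_class_of scalar_equiv.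
Proof.
split=> [g|g h|h g k].
- by apply/asboolP; exists 1; rewrite ?unitr1 ?scale1r.
- by apply/asbool_equiv_eq; split=> -[c cu e]; exists c^-1;
    rewrite ?unitrV // e scalerA mulVr ?scale1r.
- move=> /asboolP[c cu e] /asboolP[d du e']; apply/asboolP.
  by exists (c * d); rewrite ?unitrM ?cu // e e' scalerA.
Qed.
Canonical scalar_equiv_rel := EquivRelPack scalar_equiv_class.
Canonical scalar_encModRel := defaultEncModRel scalar_equiv.

(* For a local ring R, every R-point of the algebraic group PGL_2 lifts to
   GL_2(R), so that PGL_2(R) = GL_2(R) / R^*. *)
Definition PGL2 := {eq_quot scalar_equiv}.
HB.instance Definition _ := EqQuotient.on PGL2.
HB.instance Definition _ := Choice.on PGL2.

Lemma pgl2_eqP (g h : GL2 R) :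
  reflect (exists2 c : R, c \is a GRing.unit & gl2_mx g = c *: gl2_mx h)
          (g == h %[mod PGL2]).
Proof. by rewrite eqmodE; exact: asboolP. Qed.

Definition pgl2_one : PGL2 := \pi_PGL2 1%g.
Definition pgl2_mul (g h : PGL2) : PGL2 := \pi_PGL2 (repr g * repr h)%g.
Definition pgl2_inv (g : PGL2) : PGL2 := \pi_PGL2 (repr g)^-1%g.

Lemma pgl2_reprP (g : GL2 R) :
  exists2 c : R, c \is a GRing.unit & gl2_mx (repr (\pi_PGL2 g)) = c *: gl2_mx g.
Proof. by apply/pgl2_eqP; rewrite reprK. Qed.

Lemma pi_pgl2M (g h : GL2 R) :
  pgl2_mul (\pi_PGL2 g) (\pi_PGL2 h) = \pi_PGL2 (g * h)%g.
Proof.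
have [c cu ec] := pgl2_reprP g; have [d du ed] := pgl2_reprP h.
apply/eqP/pgl2_eqP; exists (c * d); first by rewrite unitrM cu.
by rewrite /= ec ed -scalemxAl -scalemxAr scalerA.
Qed.

Lemma pi_pgl2V (g : GL2 R) : pgl2_inv (\pi_PGL2 g) = \pi_PGL2 g^-1%g.
Proof.
have [c cu ec] := pgl2_reprP g.
apply/eqP/pgl2_eqP; exists c^-1; first by rewrite unitrV.
by rewrite /= ec invmxZ // -ec gl2_unit.
Qed.

Fact pgl2_mulA : associative pgl2_mul.
Proof.
elim/quotW=> g; elim/quotW=> h; elim/quotW=> k.
by rewrite (pi_pgl2M h k) (pi_pgl2M g h) pi_pgl2M (pi_pgl2M _ k) mulgA.
Qed.
Fact pgl2_mul1 : left_id pgl2_one pgl2_mul.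
Proof. by elim/quotW=> g; rewrite pi_pgl2M mul1g. Qed.
Fact pgl2_mulr1 : right_id pgl2_one pgl2_mul.
Proof. by elim/quotW=> g; rewrite pi_pgl2M mulg1. Qed.
Fact pgl2_mulV : left_inverse pgl2_one pgl2_inv pgl2_mul.
Proof. by elim/quotW=> g; rewrite pi_pgl2V pi_pgl2M mulVg. Qed.
Fact pgl2_mulrV : right_inverse pgl2_one pgl2_inv pgl2_mul.
Proof. by elim/quotW=> g; rewrite pi_pgl2V pi_pgl2M mulgV. Qed.

HB.instance Definition _ :=
  isGroup.Build PGL2 pgl2_mulA pgl2_mul1 pgl2_mulr1 pgl2_mulV pgl2_mulrV.

End GL2Group.

(* A[eps]/(eps^2), with eps = 'qX; the element a + b eps is represented by a
   polynomial p of size at most 2 with p`_0 = a and p`_1 = b. *)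
Notation dual_numbers A := {poly %/ ('X^2 : {poly A})}.

Definition dual_ge (F : discValFieldType) (n : int) (p : dual_numbers F) :=
  dval_ge n (val p)`_0 && dval_ge n (val p)`_1.

Section DualTheory.
Variable F : discValFieldType.

Lemma dual_ge_le_trans m n (p : dual_numbers F) :
  m <= n -> dual_ge n p -> dual_ge m p.
Proof.
by move=> mn /andP[p0 p1]; rewrite /dual_ge !(dval_le_trans mn).
Qed.

Lemma qX_sqr : 'qX * 'qX = 0 :> dual_numbers F.
Proof.
rewrite -[LHS](rmorphM (in_qpoly 'X^2)) /= -expr2; apply: val_inj => /=.
by rewrite mk_monic_Xn Pdiv.RingMonic.rmodpp // monicXn.
Qed.

Lemma dual_unit (c x : F) : c != 0 ->
  qpolyC 'X^2 c + 'qX * qpolyC 'X^2 x \is a GRing.unit.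
Proof.
move=> c0; set e := 'qX; set C := qpolyC _.
have ee : e * e = 0 by exact: qX_sqr.
have cV : C c * C c^-1 = 1 by rewrite -[LHS](rmorphM C) mulfV // rmorph1.
apply/unitrPr; exists (C c^-1 - e * C x * C c^-1 * C c^-1).
rewrite mulrBr mulrDl cV !mulrDl.
rewrite (_ : C c * (e * C x * C c^-1 * C c^-1) = e * C x * C c^-1); last first.
  by rewrite !mulrA -[in RHS](mulr1 (e * C x)) -cV !mulrA (mulrC (C c) e)
       -!mulrA; congr (_ * _); rewrite mulrCA.
rewrite (_ : e * C x * (e * C x * C c^-1 * C c^-1) = 0); last first.
  by rewrite !mulrA (mulrAC e (C x) e) ee !mul0r.
by rewrite addr0 addrK.
Qed.

End DualTheory.

Section Geps.
Variable F : discValFieldType.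

Definition GL2_eps : Type := GL2 (dual_numbers F).
HB.instance Definition _ := Group.on GL2_eps.

(* GL_2(F_eps) is open in M_2(F_eps) = F^8 and carries the subspace topology. *)
Definition gl2_open (U : set GL2_eps) : Prop :=
  forall g, U g -> exists n : int, forall h : GL2_eps,
    (forall i j, dual_ge n (gl2_mx h i j - gl2_mx g i j)) -> U h.

Fact gl2_openT : gl2_open setT. Proof. by move=> g _; exists 0. Qed.
Fact gl2_openI : setI_closed gl2_open.
Proof.
move=> U V oU oV g [/oU[m mU] /oV[n nV]]; exists (Num.max m n) => h hg.
by split; [apply: mU | apply: nV] => i j; apply: dual_ge_le_trans (hg i j);
  rewrite le_max lexx ?orbT.
Qed.
Fact gl2_open_bigU (I : Type) (f : I -> set GL2_eps) :
  (forall i, gl2_open (f i)) -> gl2_open (\bigcup_i f i).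
Proof.
move=> of_ g [i _ /of_[n nf]]; exists n => h /nf fh; by exists i.
Qed.
HB.instance Definition _ :=
  isOpenTopological.Build GL2_eps gl2_openT gl2_openI gl2_open_bigU.

Definition G_eps : Type := PGL2 (dual_numbers F).
HB.instance Definition _ := EqQuotient.on G_eps.
HB.instance Definition _ := Group.on G_eps.
HB.instance Definition _ := isPointed.Build G_eps 1%g.

Definition to_G_eps (g : GL2_eps) : G_eps := \pi_(PGL2 (dual_numbers F)) g.

(* the quotient topology *)
Definition G_eps_open (U : set G_eps) : Prop := open (to_G_eps @^-1` U).

Fact G_eps_openT : G_eps_open setT. Proof. exact: openT. Qed.
Fact G_eps_openI : setI_closed G_eps_open.
Proof. by move=> U V oU oV; exact: openI. Qed.
Fact G_eps_open_bigU (I : Type) (f : I -> set G_eps) :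
  (forall i, G_eps_open (f i)) -> G_eps_open (\bigcup_i f i).
Proof.
by move=> of_; rewrite /G_eps_open preimage_bigcup; apply: bigcup_open => i _;
  exact: of_.
Qed.
HB.instance Definition _ :=
  isOpenTopological.Build G_eps G_eps_openT G_eps_openI G_eps_open_bigU.

Definition borel_G_eps := g_sigma_algebraType (@open G_eps).
HB.instance Definition _ := Measurable.on borel_G_eps.

Definition GL2_int_eps : set GL2_eps :=
  [set g | forall i j, dual_ge 0 (gl2_mx g i j)
                       /\ dual_ge 0 (invmx (gl2_mx g) i j)].

Definition K_eps : set G_eps := to_G_eps @` GL2_int_eps.

Definition K_double_coset (g : G_eps) : set G_eps :=
  [set h | exists k k', [/\ K_eps k, K_eps k' & h = (k * g * k')%g]].

End Geps.

(* The Haar measure on G_eps giving K_eps volume 1; G_eps is second countable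
   and locally compact, so the regularity conditions are automatic. *)
Record is_Haar (R : realType) (F : discValFieldType)
    (mu : {measure set (borel_G_eps F) -> \bar R}) : Prop := {
  Haar_left_invariant : forall (g : G_eps F) (A : set (borel_G_eps F)),
    measurable A -> mu [set (g * h)%g | h in A] = mu A;
  Haar_compact : forall C : set (G_eps F), compact C -> (mu C < +oo)%E;
  Haar_K_eps : mu (@K_eps F) = 1%E
}.

Definition complex_integral (d : measure_display) (T : measurableType d)
    (R : realType) (mu : {measure set T -> \bar R}) (f : T -> R[i]) : R[i] :=
  Complex (\int[mu]_x complex.Re (f x)) (\int[mu]_x complex.Im (f x)).

(* f mu * f' mu = (convolution mu f f') mu as complex measures *)
Definition convolution (R : realType) (F : discValFieldType)
    (mu : {measure set (borel_G_eps F) -> \bar R}) (f f' : G_eps F -> R[i]) :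
    G_eps F -> R[i] :=
  fun g => complex_integral mu
    (fun h : borel_G_eps F => f h * f' ((h : G_eps F)^-1 * g)%g).

Section HeckeOperator.
Variables (R : realType) (F : nonArchLocalFieldType).
Variables (pi : int_ring F) (hpi : generates_max_ideal pi).

Fact generator_neq0 : int_ring_val pi != 0.
Proof.
have [x x0 vx] := @dval_surj F.
have Ox : x \in @dval_int F by rewrite inE /dval_ge vx orbT.
have /hpi[b /(congr1 val) /= xE] : IntRing Ox \in @max_ideal F.
  by rewrite inE /dval_ge /= vx orbT.
by apply: contra_neq x0 => pi0; rewrite xE pi0 mul0r.
Qed.

Definition g_mx (x : int_ring F) : 'M[dual_numbers F]_2 :=
  diag_mx (\row_j if j == 0
    then qpolyC 'X^2 (int_ring_val pi) + 'qX * qpolyC 'X^2 (int_ring_val x)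
    else 1).

Fact g_mx_unit x : g_mx x \in unitmx.
Proof.
rewrite unitmxE det_diag big_ord_recl big_ord1 !mxE /= mulr1.
exact: dual_unit generator_neq0.
Qed.

Definition g_elt (x : int_ring F) : G_eps F := to_G_eps (MkGL2 (g_mx_unit x)).

(* The double coset does not depend on the lift [repr x] of x. *)
Definition T_op (x : residue_field F) : G_eps F -> R[i] :=
  fun g => (residue_card F)%:R^-1 * \1_(K_double_coset (g_elt (repr x))) g.

End HeckeOperator.

(* Main.v *)
(** For [x = y] there is nothing to prove.  Otherwise put [D_x = K g_x K]; up to
    the factor [q^-2], the value of [T_x * T_y] at [g] is the volume of
    [D_x] meet [g D_y].  Each [D_x] is stable under inversion, since in [PGL_2]
    the inverse of [diag(a, b)] is [diag(b, a)], a Weyl conjugate.  Hence left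
    invariance turns [vol (D_y meet g D_x)] into [vol (D_x meet g^-1 D_y)], which
    equals [vol (D_x meet g D_y)] as soon as [g^-1] lies in [K g K].  This holds
    on [D_x D_y]: with [a_x = pi + eps x], any [g_x k g_y] lies in the double
    coset of [diag(a_x a_y, 1)] if the lower right entry of [k] is a unit, and of
    [diag(a_x, a_y)] otherwise, because for [x <> y] the elements [a_x] and [a_y]
    generate the maximal ideal [(pi, eps)] of [O_eps]. *)

Require Import Defs.
From mathcomp Require Import all_boot all_order all_algebra.
From mathcomp Require Import all_classical all_reals all_analysis.
From mathcomp Require Import complex.
From HB Require Import structures.
From mathcomp Require Import qpoly ring_quotient generic_quotient ring zify.
Import Order.TTheory GRing.Theory Num.Theory.
Local Open Scope ring_scope.

Set Implicit Arguments.
Unset Strict Implicit.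
Unset Printing Implicit Defensive.

(** * Coordinates on the dual numbers *)

Section DualNumbers.
Variable A : comNzRingType.
Implicit Types p r : dual_numbers A.

Definition dual_re p : A := (val p)`_0.
Definition dual_eps p : A := (val p)`_1.

(** Reduction modulo ['X^2] is truncation below degree 2, so products of dual numbers can be read
    off coefficientwise. *)
Lemma dual_valM p r : val (p * r) = take_poly 2 (val p * val r).
Proof.
have -> : val (p * r) =
  Pdiv.CommonRing.rmodp (val p * val r) (mk_monic 'X^2) by [].
move: (val p * val r) => s.
by rewrite mk_monic_Xn Pdiv.RingMonic.take_poly_rmodp.
Qed.

Lemma dual_reM p r : dual_re (p * r) = dual_re p * dual_re r.
Proof. by rewrite /dual_re dual_valM coef_take_poly coefM big_ord1. Qed.

Lemma dual_epsM p r :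
  dual_eps (p * r) = dual_re p * dual_eps r + dual_eps p * dual_re r.
Proof.
by rewrite /dual_eps dual_valM coef_take_poly coefM big_ord_recl big_ord1.
Qed.

Lemma dual_eqP p r :
  dual_re p = dual_re r -> dual_eps p = dual_eps r -> p = r.
Proof.
move=> e0 e1; apply/val_inj/polyP => -[|[|i]] //.
have big (s : dual_numbers A) : (val s)`_i.+2 = 0.
  rewrite nth_default //; apply: leq_trans (size_npoly s) _.
  by rewrite mk_monic_Xn size_polyXn.
by rewrite !big.
Qed.

Lemma dual_re1 : dual_re 1 = 1. Proof. by rewrite /dual_re coef1. Qed.

Lemma dual_eps1 : dual_eps 1 = 0. Proof. by rewrite /dual_eps coef1. Qed.

Lemma dual_reD p r : dual_re (p + r) = dual_re p + dual_re r.
Proof. by rewrite /dual_re coefD. Qed.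

Lemma dual_epsD p r : dual_eps (p + r) = dual_eps p + dual_eps r.
Proof. by rewrite /dual_eps coefD. Qed.

Lemma dual_reN p : dual_re (- p) = - dual_re p.
Proof. by rewrite /dual_re coefN. Qed.

Lemma dual_epsN p : dual_eps (- p) = - dual_eps p.
Proof. by rewrite /dual_eps coefN. Qed.

Lemma dual_reC a : dual_re (qpolyC 'X^2 a) = a.
Proof. by rewrite /dual_re coefC. Qed.

Lemma dual_epsC a : dual_eps (qpolyC 'X^2 a) = 0.
Proof. by rewrite /dual_eps coefC. Qed.

Lemma val_dual_qX : val ('qX : dual_numbers A) = 'X :> {poly A}.
Proof.
have -> : val ('qX : dual_numbers A) =
  Pdiv.CommonRing.rmodp 'X (mk_monic 'X^2) by [].
by rewrite mk_monic_Xn -Pdiv.RingMonic.take_poly_rmodp take_poly_id ?size_polyX.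
Qed.

Lemma dual_reX : dual_re 'qX = 0.
Proof. by rewrite /dual_re val_dual_qX coefX. Qed.

Lemma dual_epsX : dual_eps 'qX = 1.
Proof. by rewrite /dual_eps val_dual_qX coefX. Qed.

End DualNumbers.

(** * The local ring [O_eps] inside [F_eps] *)

Section Integral.
Variable F : discValFieldType.
Implicit Types p r : dual_numbers F.

Lemma dual_geE n p : dual_ge n p = dval_ge n (dual_re p) && dval_ge n (dual_eps p).
Proof. by []. Qed.

Lemma dual_geD n p r : dual_ge n p -> dual_ge n r -> dual_ge n (p + r).
Proof.
rewrite !dual_geE dual_reD dual_epsD => /andP[p0 p1] /andP[r0 r1].
by rewrite !dval_geD.
Qed.

Lemma dual_geN n p : dual_ge n (- p) = dual_ge n p.
Proof. by rewrite !dual_geE dual_reN dual_epsN !dval_geN. Qed.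

Lemma dual_geM m n p r :
  dual_ge m p -> dual_ge n r -> dual_ge (m + n) (p * r).
Proof.
rewrite !dual_geE dual_reM dual_epsM => /andP[p0 p1] /andP[r0 r1].
by rewrite dval_geM ?dval_geD ?dval_geM.
Qed.

(** This is [O_eps], taken as a subring of [F_eps] so that integral and non-integral elements
    multiply without coercions. *)
Definition dual_int : {pred dual_numbers F} := [pred p | dual_ge 0 p].

Lemma dual_int_subring : subring_closed dual_int.
Proof.
split=> [|p r|p r]; rewrite !inE.
- by rewrite dual_geE dual_re1 dual_eps1 dval_ge0 /dval_ge dval1 lexx orbT.
- by move=> op oq; rewrite dual_geD // dual_geN.
- by rewrite -[X in dual_ge X (_ * _)]addr0; apply: dual_geM.
Qed.
HB.instance Definition _ :=
  GRing.isSubringClosed.Build (dual_numbers F) dual_int dual_int_subring.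

Lemma dual_intC a : (qpolyC 'X^2 a \in dual_int) = dval_ge 0 a.
Proof. by rewrite inE dual_geE dual_reC dual_epsC dval_ge0 andbT. Qed.

Lemma dual_intX : 'qX \in dual_int.
Proof.
by rewrite inE dual_geE dual_reX dual_epsX dval_ge0 /dval_ge dval1 lexx orbT.
Qed.

Lemma dval_ge1_one : ~~ dval_ge 1 (1 : F).
Proof. by rewrite /dval_ge oner_eq0 dval1. Qed.

Lemma dval_unit_inv (a : F) :
  dval_ge 0 a -> ~~ dval_ge 1 a -> (a != 0) && dval_ge 0 a^-1.
Proof.
rewrite /dval_ge; have [->//|a0 /= va] := eqVneq a 0.
rewrite -ltNge invr_eq0 (negbTE a0) /= => va1.
have va0 : dval a = 0 by lia.
have := dvalM a0 (invr_neq0 a0).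
by rewrite mulfV // dval1 va0 add0r => <-.
Qed.

(** [O_eps] is local with maximal ideal [(pi, eps)], so only the real part decides invertibility:
    the inverse of [a + b eps] is [a^-1 - b a^-2 eps]. *)
Lemma dual_int_inv p : p \in dual_int -> ~~ dval_ge 1 (dual_re p) ->
  (p \is a GRing.unit) && (p^-1 \in dual_int).
Proof.
rewrite inE dual_geE => /andP[vp vep] vp1.
have /andP[p0 vpi] := dval_unit_inv vp vp1.
set a := dual_re p in p0 vp vp1 vpi *.
pose b := dual_eps p * (a^-1 * a^-1).
pose r := qpolyC 'X^2 a^-1 - 'qX * qpolyC 'X^2 b.
have pr : p * r = 1.
  rewrite /r; apply: dual_eqP.
    rewrite dual_reM dual_reD dual_reN dual_reM !dual_reC dual_reX.
    by rewrite mul0r subr0 mulfV.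
  rewrite dual_epsM dual_reD dual_reN dual_epsD dual_epsN dual_reM dual_epsM.
  rewrite !dual_reC !dual_epsC dual_reX dual_epsX -/a /b; field.
  exact: p0.
rewrite (mulr1_eq pr); apply/andP; split; first by apply/unitrPr; exists r.
rewrite rpredB ?rpredM ?dual_intX ?dual_intC //.
by do ! (rewrite -[0]addr0; apply: dval_geM => //).
Qed.

Lemma dual_unit_re p : p \in dual_int -> p^-1 \in dual_int ->
  p \is a GRing.unit -> ~~ dval_ge 1 (dual_re p).
Proof.
move=> op; rewrite inE dual_geE => /andP[opi _] up.
(* Otherwise the real part of [p * p^-1 = 1] would have valuation at least 1. *)
apply/negP => vp; have := dval_geM vp opi.
by rewrite -dual_reM divrr // dual_re1 addr0 (negbTE dval_ge1_one).
Qed.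

End Integral.

(** * Explicit 2 by 2 matrix identities *)

Section Matrix2.
Variable A : comUnitRingType.

Definition mat2 (a b c d : A) : 'M[A]_2 :=
  \matrix_(i, j) if i == 0 then (if j == 0 then a else b)
                 else (if j == 0 then c else d).

Lemma mat2E (M : 'M[A]_2) : M = mat2 (M 0 0) (M 0 1) (M 1 0) (M 1 1).
Proof.
apply/matrixP=> i j; rewrite mxE.
by case: i => -[|[|//]] hi; case: j => -[|[|//]] hj /=; congr (M _ _);
  apply: val_inj.
Qed.

Lemma mul_mat2 a b c d a' b' c' d' :
  mat2 a b c d *m mat2 a' b' c' d' =
  mat2 (a * a' + b * c') (a * b' + b * d') (c * a' + d * c') (c * b' + d * d').
Proof.
apply/matrixP=> i j; rewrite !mxE big_ord_recl big_ord1 !mxE /=.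
by case: ifP => _; case: ifP.
Qed.

Lemma det_mat2 a b c d : \det (mat2 a b c d) = a * d - b * c.
Proof.
rewrite (expand_det_row _ 0) big_ord_recl big_ord1 /cofactor !det_mx11 !mxE /=.
by rewrite expr0 expr1 mul1r mulN1r mulrN.
Qed.

Lemma scale_mat2 k a b c d :
  k *: mat2 a b c d = mat2 (k * a) (k * b) (k * c) (k * d).
Proof.
by apply/matrixP=> i j; rewrite !mxE; case: ifP => _; case: ifP.
Qed.

Lemma mat2_1 : mat2 1 0 0 1 = 1%:M.
Proof.
apply/matrixP=> i j; rewrite !mxE.
by case: i => -[|[|//]] hi; case: j => -[|[|//]] hj.
Qed.

Lemma invmx_mat2 a b c d : mat2 a b c d \in unitmx ->
  invmx (mat2 a b c d) =
  (a * d - b * c)^-1 *: mat2 d (- b) (- c) a.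
Proof.
rewrite unitmxE det_mat2 => u.
have H : mat2 a b c d *m ((a * d - b * c)^-1 *: mat2 d (- b) (- c) a) = 1%:M.
  rewrite -scalemxAr mul_mat2 scale_mat2 -mat2_1.
  congr mat2; rewrite ?mulrN ?addrN ?mulr0 ?mulVr ?(mulrC c) //.
  - by rewrite (mulrC b a) addNr mulr0.
  - by rewrite (mulrC d) addrN mulr0.
  - by rewrite [X in _ * X]addrC (mulrC d) mulVr.
have U : mat2 a b c d \in unitmx by rewrite unitmxE det_mat2.
by rewrite -[RHS]mul1mx -(mulVmx U) -mulmxA H mulmx1.
Qed.

Lemma all_ord2 (P : 'I_2 -> Prop) : P 0 -> P 1 -> forall i, P i.
Proof.
move=> P0 P1 [[|[|//]] hi].
- by rewrite (_ : Ordinal hi = 0) //; apply: val_inj.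
- by rewrite (_ : Ordinal hi = 1) //; apply: val_inj.
Qed.

Lemma det_mat2_diag a b : \det (mat2 a 0 0 b) = a * b.
Proof. by rewrite det_mat2 mulr0 subr0. Qed.

Lemma lower_det (a : A) : 1 * 1 - 0 * a = 1.
Proof. by rewrite mul0r mulr1 subr0. Qed.

Lemma upper_det (a : A) : 1 * 1 - a * 0 = 1.
Proof. by rewrite mulr0 mulr1 subr0. Qed.

Lemma cartan_corner_det (y a b c d : A) : d \is a GRing.unit ->
  (a - b * c / d) * d - 0 * (y * c) = a * d - b * c.
Proof. by move=> ud; rewrite mul0r subr0 mulrBl divrK. Qed.

Lemma cartan_mixed_det (x y a b c r s : A) : b \is a GRing.unit ->
  y * a * s - b * (c - r * x * a / b) = a * (r * x + s * y) - b * c.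
Proof.
move=> ub; rewrite mulrBr [b * (_ / b)]mulrC divrK //; ring.
Qed.

Lemma cartan_product (x y a b c d : A) :
  mat2 x 0 0 1 *m mat2 a b c d *m mat2 y 0 0 1 =
  mat2 (x * y * a) (x * b) (y * c) d.
Proof.
rewrite !mul_mat2 !(mul0r, mulr0, mul1r, mulr1, add0r, addr0).
by congr mat2; ring.
Qed.

(** Subtracting [x * b / d] times the second row from the first clears the upper right entry and
    leaves a first row divisible by [x * y]. *)
Lemma cartan_unit_corner (x y a b c d : A) : d \is a GRing.unit ->
  mat2 (x * y * a) (x * b) (y * c) d =
  mat2 1 (x * b / d) 0 1 *m mat2 (x * y) 0 0 1 *m mat2 (a - b * c / d) 0 (y * c) d.
Proof.
move=> ud; rewrite !mul_mat2 !(mul0r, mulr0, mul1r, mulr1, add0r, addr0).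
congr mat2 => //.
- by ring.
- by rewrite divrK.
Qed.

(** The first row is divisible by [x]. Subtracting [r / b] times it from the second removes the term
    [r * x] of the corner, after which the second row is divisible by [y]. *)
Lemma cartan_mixed (x y a b c r s : A) : b \is a GRing.unit ->
  mat2 (x * y * a) (x * b) (y * c) (r * x + s * y) =
  mat2 1 0 (r / b) 1 *m mat2 x 0 0 y *m mat2 (y * a) b (c - r * x * a / b) s.
Proof.
move=> ub; rewrite !mul_mat2 !(mul0r, mulr0, mul1r, mulr1, add0r, addr0).
congr mat2 => //.
- by rewrite mulrA.
- by ring.
- by rewrite -mulrA [x * b]mulrC mulrA divrK // [s * y]mulrC.
Qed.

Lemma invmx_diag_weyl (a b : A) : mat2 a 0 0 b \in unitmx ->
  invmx (mat2 a 0 0 b) =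
  (a * b)^-1 *: (mat2 0 1 1 0 *m mat2 a 0 0 b *m mat2 0 1 1 0).
Proof.
move=> u; rewrite invmx_mat2 // !mul_mat2.
by rewrite !(mul0r, mulr0, mul1r, mulr1, add0r, addr0, oppr0).
Qed.

End Matrix2.

(** * The subgroup [K_eps] and its double cosets *)

Section CompactSubgroup.
Variable F : discValFieldType.
Local Notation D := (dual_numbers F).
Local Notation dual_int := (@dual_int F).
Local Notation to_G := (@to_G_eps F).
Local Notation K := (@K_eps F).
Implicit Types (g h k : GL2_eps F).

(** The inverse is the adjugate divided by the determinant; conversely the inverse determinant is a
    polynomial in the entries of the inverse. *)
Lemma GL2_intP g : GL2_int_eps g <->
  (forall i j, gl2_mx g i j \in dual_int) /\ (\det (gl2_mx g))^-1 \in dual_int.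
Proof.
split=> [og|[og odet]].
- split=> [i j|]; first by have [] := og i j.
  rewrite -det_inv (mat2E (invmx g)) det_mat2.
  have oV i j : invmx (gl2_mx g) i j \in dual_int by have [] := og i j.
  by rewrite rpredB // rpredM.
- move=> i j; split; first exact: og.
  rewrite /invmx gl2_unit mxE mxE /cofactor det_mx11 !mxE.
  by rewrite -[dual_ge _ _]/(_ \in dual_int) rpredM // rpredM ?rpred_sign.
Qed.

Lemma GL2_int1 : GL2_int_eps (1%g : GL2_eps F).
Proof.
apply/GL2_intP; split=> [i j|]; last by rewrite det1 invr1 rpred1.
by rewrite mxE; case: (i == j); rewrite ?rpred1 ?rpred0.
Qed.

Lemma GL2_intM g h : GL2_int_eps g -> GL2_int_eps h -> GL2_int_eps (g * h)%g.
Proof.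
move=> /GL2_intP[og dg] /GL2_intP[oh dh]; apply/GL2_intP; split=> [i j|].
  by rewrite mxE rpred_sum // => l _; rewrite rpredM.
by rewrite /= det_mulmx invrM -?unitmxE ?gl2_unit // rpredM.
Qed.

Lemma GL2_intV g : GL2_int_eps g -> GL2_int_eps (g^-1)%g.
Proof.
by move=> og i j; rewrite /= invmxK; have [] := og i j.
Qed.

Lemma to_GM g h : to_G (g * h)%g = (to_G g * to_G h)%g.
Proof. by rewrite /to_G_eps -pi_pgl2M. Qed.

Lemma to_GV g : to_G g^-1%g = (to_G g)^-1%g.
Proof. by rewrite /to_G_eps -pi_pgl2V. Qed.

Lemma K_eps1 : K 1%g.
Proof. by exists 1%g; [exact: GL2_int1|]. Qed.

Lemma K_epsM u v : K u -> K v -> K (u * v)%g.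
Proof.
move=> [g og <-] [h oh <-]; exists (g * h)%g; [exact: GL2_intM|].
exact: to_GM.
Qed.

Lemma K_epsV u : K u -> K u^-1%g.
Proof.
move=> [g og <-]; exists (g^-1)%g; [exact: GL2_intV | exact: to_GV].
Qed.

Implicit Types u v w : G_eps F.

Lemma K_double_coset_mul u v (k k' : G_eps F) : K k -> K k' ->
  K_double_coset u v -> K_double_coset u (k * v * k')%g.
Proof.
move=> Kk Kk' [l [l' [Kl Kl' ->]]]; exists (k * l)%g, (l' * k')%g.
by split; [exact: K_epsM | exact: K_epsM | rewrite !mulgA].
Qed.

Lemma K_double_coset_sym u v : K_double_coset u v -> K_double_coset v u.
Proof.
move=> [k [k' [Kk Kk' ->]]]; exists k^-1%g, k'^-1%g.
by split; [exact: K_epsV | exact: K_epsV | rewrite !mulgA mulVg mul1g mulgK].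
Qed.

Lemma K_double_coset_trans u v w :
  K_double_coset u v -> K_double_coset v w -> K_double_coset u w.
Proof. by move=> uv [k [k' [Kk Kk' ->]]]; apply: K_double_coset_mul. Qed.

Lemma K_double_cosetV u v : K_double_coset u v -> K_double_coset u^-1%g v^-1%g.
Proof.
move=> [k [k' [Kk Kk' ->]]]; exists k'^-1%g, k^-1%g.
by split; [exact: K_epsV | exact: K_epsV | rewrite !invgM mulgA].
Qed.

(** Lying in the same double coset as one's inverse depends only on the double coset, so it can be
    tested on a diagonal representative. *)
Lemma K_double_coset_invol u v :
  K_double_coset u u^-1%g -> K_double_coset u v -> K_double_coset v v^-1%g.
Proof.
move=> uV uv; apply: K_double_coset_trans (K_double_cosetV uv).
exact: K_double_coset_trans (K_double_coset_sym uv) uV.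
Qed.

(** Transfers matrix factorizations to the projective group, where the scalar [c] becomes
    trivial. *)
Lemma K_double_coset_mx g h k k' (c : D) : c \is a GRing.unit ->
  GL2_int_eps k -> GL2_int_eps k' ->
  gl2_mx h = c *: (gl2_mx k *m gl2_mx g *m gl2_mx k') ->
  K_double_coset (to_G g) (to_G h).
Proof.
move=> uc ok ok' e; exists (to_G k), (to_G k'); split.
- by exists k.
- by exists k'.
by rewrite -!to_GM; apply/eqP/pgl2_eqP; exists c.
Qed.

Lemma mat2_GL2_int (a b c d : D) :
  a \in dual_int -> b \in dual_int -> c \in dual_int -> d \in dual_int ->
  a * d - b * c \is a GRing.unit -> (a * d - b * c)^-1 \in dual_int ->
  exists2 k, GL2_int_eps k & gl2_mx k = mat2 a b c d.
Proof.
move=> oa ob oc od u ou.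
have U : mat2 a b c d \in unitmx by rewrite unitmxE det_mat2.
exists (MkGL2 U) => //; apply/GL2_intP; rewrite /= det_mat2; split=> // i j.
by rewrite mxE; case: ifP => _; case: ifP.
Qed.

(** Up to the scalar [(a * b)^-1], the inverse is the conjugate by the Weyl element, which is
    integral. *)
Lemma diag_double_cosetV g (a b : D) : gl2_mx g = mat2 a 0 0 b ->
  K_double_coset (to_G g) (to_G g)^-1%g.
Proof.
move=> eg; have ug := gl2_unit g; rewrite eg in ug.
have uab : a * b \is a GRing.unit.
  by move: ug; rewrite unitmxE det_mat2 mulr0 subr0.
have [w ow ew] : exists2 k, GL2_int_eps k & gl2_mx k = mat2 (0 : D) 1 1 0.
  apply: mat2_GL2_int; rewrite ?rpred0 ?rpred1 //.
    by rewrite mul0r mul1r sub0r unitrN unitr1.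
  by rewrite mul0r mul1r sub0r invrN invr1 rpredN rpred1.
rewrite -to_GV; apply: (K_double_coset_mx (c := (a * b)^-1) _ ow ow).
  by rewrite unitrV.
by rewrite /= ew eg invmx_diag_weyl.
Qed.

End CompactSubgroup.

(** * Products of the double cosets of [g_x] and [g_y] *)

Section Products.
Variables (F : nonArchLocalFieldType) (pi : int_ring F).
Hypothesis hpi : generates_max_ideal pi.
Local Notation D := (dual_numbers F).
Local Notation dual_int := (@dual_int F).

Definition cartan_entry (x : int_ring F) : D :=
  qpolyC 'X^2 (int_ring_val pi) + 'qX * qpolyC 'X^2 (int_ring_val x).

Lemma g_mxE x : g_mx pi x = mat2 (cartan_entry x) 0 0 1.
Proof.
by apply/matrixP; elim/all_ord2; elim/all_ord2; rewrite !mxE.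
Qed.

Lemma cartan_entry_int x : cartan_entry x \in dual_int.
Proof.
rewrite rpredD ?rpredM ?dual_intX ?dual_intC //; first exact: (valP pi).
exact: (valP x).
Qed.

Lemma cartan_entry_unit x : cartan_entry x \is a GRing.unit.
Proof. exact: dual_unit (generator_neq0 hpi). Qed.

(** The difference [a_x - a_y = eps (x - y)] has [x - y] a unit of [O], so [eps], and with it [pi],
    lies in the ideal generated by [a_x] and [a_y]. *)
Lemma dual_max_ideal_span (x y : int_ring F) (p : D) :
  x - y \notin @max_ideal F -> p \in dual_int -> dval_ge 1 (dual_re p) ->
  exists r s, [/\ r \in dual_int, s \in dual_int &
    p = r * cartan_entry x + s * cartan_entry y].
Proof.
move=> nxy; rewrite inE dual_geE => /andP[p0 p1] mp.
have [b eb] : exists b : int_ring F, dual_re p = int_ring_val pi * int_ring_val b.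
  have [+ _] := hpi (IntRing p0); case; first by rewrite inE.
  by move=> b /(congr1 val) /= ->; exists b.
set u := int_ring_val x - int_ring_val y.
have ou : dval_ge 0 u by exact: (valP (x - y)).
have /andP[u0 oui] : (u != 0) && dval_ge 0 u^-1.
  by apply: dval_unit_inv => //; move: nxy; rewrite inE.
(* With [dual_re p = pi b], the remainder [p - b a_x] is [(dual_eps p - b x) eps], and
   [eps = u^-1 (a_x - a_y)]; hence it equals [t (a_x - a_y)]. *)
pose t := qpolyC 'X^2 (dual_eps p - int_ring_val b * int_ring_val x) *
          qpolyC 'X^2 u^-1 : D.
have ot : t \in dual_int.
  rewrite rpredM ?dual_intC // dval_geD // dval_geN -[0]addr0.
  by apply: dval_geM; [exact: (valP b) | exact: (valP x)].
exists (qpolyC 'X^2 (int_ring_val b) + t), (- t); split.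
- by rewrite rpredD // dual_intC; exact: (valP b).
- by rewrite rpredN.
rewrite /t /cartan_entry; apply: dual_eqP.
  rewrite !dual_reD !dual_reM !dual_reD !dual_reN !dual_reM !dual_reC dual_reX eb.
  by ring.
rewrite !(dual_epsD, dual_reD, dual_epsM, dual_reM, dual_reN, dual_epsN).
rewrite !dual_reC !dual_epsC dual_reX dual_epsX.
rewrite /u in u0 *; field.
exact: u0.
Qed.

Lemma g_elt_product (x y : int_ring F) (k : G_eps F) :
  x - y \notin @max_ideal F -> K_eps k ->
  exists2 g : GL2_eps F, exists a b, gl2_mx g = mat2 a 0 0 b &
    K_double_coset (to_G_eps g) (g_elt hpi x * k * g_elt hpi y)%g.
Proof.
move=> nxy [h oh <-].
have /GL2_intP[oM odet] := oh.
have udet : \det (gl2_mx h) \is a GRing.unit by rewrite -unitmxE gl2_unit.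
have odet1 : \det (gl2_mx h) \in dual_int.
  by rewrite (mat2E (gl2_mx h)) det_mat2 rpredB // rpredM.
set a := gl2_mx h 0 0; set b := gl2_mx h 0 1.
set c := gl2_mx h 1 0; set d := gl2_mx h 1 1.
have oa : a \in dual_int by exact: oM.
have ob : b \in dual_int by exact: oM.
have oc : c \in dual_int by exact: oM.
have od : d \in dual_int by exact: oM.
have eh : gl2_mx h = mat2 a b c d by rewrite [LHS]mat2E.
have edet : \det (gl2_mx h) = a * d - b * c by rewrite eh det_mat2.
set X := cartan_entry x; set Y := cartan_entry y.
have oX : X \in dual_int by exact: cartan_entry_int.
have oY : Y \in dual_int by exact: cartan_entry_int.
have uX : X \is a GRing.unit by exact: cartan_entry_unit.
have uY : Y \is a GRing.unit by exact: cartan_entry_unit.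
have diagU (s t : D) : s \is a GRing.unit -> t \is a GRing.unit ->
    mat2 s 0 0 t \in unitmx.
  by move=> us ut; rewrite unitmxE det_mat2_diag unitrM us.
rewrite /g_elt -!to_GM.
set w := (_ * _)%g.
have ew : gl2_mx w = mat2 (X * Y * a) (X * b) (Y * c) d.
  by rewrite /w /= !g_mxE eh -/X -/Y cartan_product.
have [md|nd] := boolP (dval_ge 1 (dual_re d)).
- have [r [s [or os ed]]] := dual_max_ideal_span nxy od md.
  (* As [d] is in the maximal ideal, [b] cannot be: otherwise [a * d - b * c] would not be a unit of
     [O_eps]. *)
  have /andP[ub obi] : (b \is a GRing.unit) && (b^-1 \in dual_int).
    apply: dual_int_inv => //; apply/negP => mb.
    have /negP := dual_unit_re odet1 odet udet; apply.
    rewrite edet dual_reD dual_reN !dual_reM dval_geD ?dval_geN //.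
      by rewrite -[1]add0r dval_geM //; move: oa => /andP[].
    by rewrite -[1]addr0 dval_geM //; move: oc => /andP[].
  exists (MkGL2 (diagU _ _ uX uY)); first by exists X, Y.
  have [k1 ok1 ek1] : exists2 k, GL2_int_eps k & gl2_mx k = mat2 1 0 (r / b) 1.
    by apply: mat2_GL2_int;
      rewrite ?lower_det ?rpred0 ?rpred1 ?unitr1 ?invr1 ?rpredM ?rpred1.
  have [k2 ok2 ek2] : exists2 k, GL2_int_eps k &
      gl2_mx k = mat2 (Y * a) b (c - r * X * a / b) s.
    (* The right factor inherits the determinant of [h], so it lies in [GL_2(O_eps)]. *)
    have e : Y * a * s - b * (c - r * X * a / b) = \det (gl2_mx h).
      by rewrite edet ed cartan_mixed_det.
    by apply: mat2_GL2_int; rewrite ?e // ?rpredB ?rpredM.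
  apply: (K_double_coset_mx (unitr1 _) ok1 ok2).
  by rewrite scale1r ew ek1 ek2 ed cartan_mixed.
- have /andP[ud odi] := dual_int_inv od nd.
  have uXY : X * Y \is a GRing.unit by rewrite unitrM uX.
  exists (MkGL2 (diagU _ _ uXY (unitr1 _))); first by exists (X * Y), 1.
  have [k1 ok1 ek1] : exists2 k, GL2_int_eps k & gl2_mx k = mat2 1 (X * b / d) 0 1.
    by apply: mat2_GL2_int;
      rewrite ?upper_det ?rpred0 ?rpred1 ?unitr1 ?invr1 ?rpredM ?rpred1.
  have [k2 ok2 ek2] : exists2 k, GL2_int_eps k &
      gl2_mx k = mat2 (a - b * c / d) 0 (Y * c) d.
    have e : (a - b * c / d) * d - 0 * (Y * c) = \det (gl2_mx h).
      by rewrite edet cartan_corner_det.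
    by apply: mat2_GL2_int; rewrite ?e // ?rpred0 ?rpredB ?rpredM.
  apply: (K_double_coset_mx (unitr1 _) ok1 ok2).
  by rewrite scale1r ew ek1 ek2 cartan_unit_corner.
Qed.

(** The two inner factors from [K_eps] merge into one, which puts [u * v] in the double coset of
    some [g_x k g_y], hence of a diagonal matrix. *)
Lemma K_double_coset_product_invol (x y : int_ring F) (u v : G_eps F) :
  x - y \notin @max_ideal F ->
  K_double_coset (g_elt hpi x) u -> K_double_coset (g_elt hpi y) v ->
  K_double_coset (u * v)%g (u * v)^-1%g.
Proof.
move=> nxy [k1 [k2 [K1 K2 ->]]] [k3 [k4 [K3 K4 ->]]].
have [g [a [b eg]] gk] := g_elt_product nxy (K_epsM K2 K3).
apply: K_double_coset_invol (diag_double_cosetV eg) _.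
have -> : (k1 * g_elt hpi x * k2 * (k3 * g_elt hpi y * k4) =
           k1 * (g_elt hpi x * (k2 * k3) * g_elt hpi y) * k4)%g.
  by rewrite !mulgA.
exact: K_double_coset_mul.
Qed.

Lemma K_double_coset_g_eltV x u :
  K_double_coset (g_elt hpi x) u -> K_double_coset (g_elt hpi x) u^-1%g.
Proof.
move=> xu; apply: K_double_coset_trans (K_double_cosetV xu).
by apply: diag_double_cosetV; exact: g_mxE.
Qed.

End Products.

Local Open Scope classical_set_scope.

(** * Openness of unions of left cosets of [K_eps] *)

Section Topology.
Variable F : discValFieldType.
Local Notation D := (dual_numbers F).

Lemma dual_ge_exists (p : D) : exists m : int, dual_ge m p.
Proof.
exists (Num.min (dval (dual_re p)) (dval (dual_eps p))).
by rewrite dual_geE /dval_ge !ge_min !lexx !orbT.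
Qed.

Lemma mx_dual_ge_exists (M : 'M[D]_2) : exists m : int, forall i j, dual_ge m (M i j).
Proof.
have row_bound i : exists m : int, forall j, dual_ge m (M i j).
  have [m0 b0] := dual_ge_exists (M i 0).
  have [m1 b1] := dual_ge_exists (M i 1).
  exists (Num.min m0 m1); elim/all_ord2.
    by apply: dual_ge_le_trans b0; rewrite ge_min lexx.
  by apply: dual_ge_le_trans b1; rewrite ge_min lexx orbT.
have [m0 b0] := row_bound 0; have [m1 b1] := row_bound 1.
exists (Num.min m0 m1); elim/all_ord2 => j.
  by apply: dual_ge_le_trans (b0 j); rewrite ge_min lexx.
by apply: dual_ge_le_trans (b1 j); rewrite ge_min lexx orbT.
Qed.

(** The determinant of [1 + N] is 1 plus terms of valuation at least 1, so it is a unit of [O_eps].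
    This makes the integral subgroup a neighbourhood of the identity. *)
Lemma GL2_int_near1 (g : GL2_eps F) :
  (forall i j, dual_ge 1 ((gl2_mx g - 1%:M) i j)) -> GL2_int_eps g.
Proof.
move=> g1; have [N eg N1] : exists2 N, gl2_mx g = 1%:M + N &
    forall i j, dual_ge 1 (N i j).
  by exists (gl2_mx g - 1%:M); rewrite // addrC subrK.
have oN i j : N i j \in @dual_int F by exact: dual_ge_le_trans (N1 i j).
have og i j : gl2_mx g i j \in @dual_int F.
  by rewrite eg mxE rpredD // mxE; case: (i == j); rewrite ?rpred1 ?rpred0.
have edet : \det (gl2_mx g) =
    1 + (N 0 0 + (N 1 1 + N 0 0 * N 1 1 + - (N 0 1 * N 1 0))).
  rewrite (mat2E (gl2_mx g)) det_mat2 eg !mxE /= !mulr1n !mulr0n !add0r.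
  by ring.
have det1 : dual_ge 1 (\det (gl2_mx g) - 1).
  have gM (p q : D) : dual_ge 1 p -> q \in @dual_int F -> dual_ge 1 (p * q).
    by move=> p1 q0; rewrite -[1]addr0; apply: dual_geM.
  rewrite edet [1 + _]addrC addrK.
  by apply: dual_geD => //; apply: dual_geD; [apply: dual_geD|]; rewrite ?dual_geN ?gM.
have odet : \det (gl2_mx g) \in @dual_int F.
  by rewrite (mat2E (gl2_mx g)) det_mat2 rpredB // rpredM.
apply/GL2_intP; split=> //.
suff : ~~ dval_ge 1 (dual_re (\det (gl2_mx g))).
  by move=> /(dual_int_inv odet)/andP[].
move: det1; rewrite dual_geE => /andP[+ _]; rewrite dual_reD dual_reN dual_re1.
rewrite -dval_geN => d1; apply: contra (dval_ge1_one F) => d2.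
by have := dval_geD d2 d1; rewrite opprB addrC subrK.
Qed.

Lemma K_right_invariant_open (U : set (G_eps F)) :
  (forall u k, U u -> K_eps k -> U (u * k)%g) -> open U.
Proof.
move=> Uk; change (gl2_open (@to_G_eps F @^-1` U)) => g Ug.
have [m gm] := mx_dual_ge_exists (invmx (gl2_mx g)).
(* The entries of [g^-1] have valuation at least [m], so those of [g^-1 (h - g) = g^-1 h - 1] have
   valuation at least 1. *)
exists (1 - m) => h hg.
have -> : h = (g * (g^-1 * h))%g by rewrite mulVKg.
rewrite /preimage /= to_GM; apply: Uk => //; exists (g^-1 * h)%g => //.
apply: GL2_int_near1 => i j.
have -> : gl2_mx (g^-1 * h)%g - 1%:M = invmx (gl2_mx g) *m (gl2_mx h - gl2_mx g).
  by rewrite mulmxBr mulVmx // gl2_unit.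
rewrite mxE big_ord_recl big_ord1.
have term l : dual_ge 1 (invmx (gl2_mx g) i l * (gl2_mx h - gl2_mx g) l j).
  by rewrite -(subrKC m 1); apply: dual_geM => //; have := hg l j; rewrite !mxE.
by apply: dual_geD; apply: term.
Qed.

End Topology.

(** * Convolution as a volume, and commutativity *)

Section Commutation.
Variables (R : realType) (F : nonArchLocalFieldType) (pi : int_ring F).
Hypothesis hpi : generates_max_ideal pi.
Variable mu : {measure set (borel_G_eps F) -> \bar R}.
Local Notation DC x := (K_double_coset (g_elt hpi x)).

(** The set [D_x] meet [g D_y], written as the support of the convolution integrand at [g]. *)
Definition conv_support (x y : int_ring F) (g : G_eps F) : set (borel_G_eps F) :=
  [set h : G_eps F | DC x h /\ DC y (h^-1 * g)%g].

Lemma conv_support_measurable x y g : measurable (conv_support x y g).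
Proof.
apply: sub_sigma_algebra; apply: K_right_invariant_open => u k [xu yu] Kk.
split.
  by rewrite -[u]mul1g; apply: K_double_coset_mul => //; exact: K_eps1.
have -> : ((u * k)^-1 * g = k^-1 * (u^-1 * g) * 1)%g by rewrite invgM mulg1 mulgA.
by apply: K_double_coset_mul => //; [exact: K_epsV | exact: K_eps1].
Qed.

Hypothesis hmu : is_Haar mu.

Lemma mu_translate (u : G_eps F) (A B : set (borel_G_eps F)) :
  measurable A -> (forall v : G_eps F, B (u * v)%g <-> A v) -> mu B = mu A.
Proof.
move=> mA BA; rewrite -(Haar_left_invariant hmu u mA); congr (mu _).
apply/seteqP; split=> [v Bv|_ [v Av <-]]; last exact/BA.
by exists (u^-1 * v)%g; [apply/BA|]; rewrite mulVKg.
Qed.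

(** Translation by [k] matches the two sets, since [D_x] and [D_y] absorb [k] and [k']. *)
Lemma conv_support_mulK x y (g k k' : G_eps F) : K_eps k -> K_eps k' ->
  mu (conv_support x y (k * g * k')%g) = mu (conv_support x y g).
Proof.
move=> Kk Kk'; apply: (mu_translate (u := k)) => [|v].
  exact: conv_support_measurable.
have e : ((k * v)^-1 * (k * g * k') = v^-1 * g * k')%g.
  by rewrite invgM -!mulgA mulKg.
rewrite /conv_support /= e; split=> -[xv yv]; split.
- have := K_double_coset_mul (K_epsV Kk) (K_eps1 F) xv.
  by rewrite mulg1 mulKg.
- have := K_double_coset_mul (K_eps1 F) (K_epsV Kk') yv.
  by rewrite mul1g mulgK.
- by rewrite -[(k * v)%g]mulg1; apply: K_double_coset_mul => //; exact: K_eps1.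
- by rewrite -[(_ * k')%g]mul1g mulgA; apply: K_double_coset_mul => //; exact: K_eps1.
Qed.

(** Substituting [h = g v] turns the conditions into [g v] in [D_y] and [v^-1] in [D_x]; stability
    of both double cosets under inversion exchanges the roles. *)
Lemma conv_support_inv x y (g : G_eps F) :
  mu (conv_support y x g) = mu (conv_support x y g^-1%g).
Proof.
apply: (mu_translate (u := g)) => [|v]; first exact: conv_support_measurable.
have e : ((g * v)^-1 * g = v^-1)%g by rewrite invgM -mulgA mulVg mulg1.
rewrite /conv_support /= e; split=> -[h1 h2]; split.
- by rewrite -[v]invgK; apply: K_double_coset_g_eltV.
- by rewrite -invgM; apply: K_double_coset_g_eltV.
- by rewrite -[(g * v)%g]invgK invgM; apply: K_double_coset_g_eltV.
- exact: K_double_coset_g_eltV.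
Qed.

Lemma conv_support_comm x y g : x - y \notin @max_ideal F ->
  mu (conv_support x y g) = mu (conv_support y x g).
Proof.
move=> nxy; have nyx : y - x \notin @max_ideal F by rewrite -opprB rpredN.
have [[k [k' [Kk Kk' gV]]]|ng] := pselect (K_double_coset g g^-1%g).
  by rewrite conv_support_inv gV conv_support_mulK.
(* A point [h] of the support would write [g = h (h^-1 g)] as an element of [D_a D_b], contradicting
   [ng]; so both volumes vanish. *)
have empty a b : a - b \notin @max_ideal F -> conv_support a b g = set0.
  move=> nab; apply/seteqP; split=> // h [ah bh]; apply: ng.
  have := K_double_coset_product_invol nab ah bh.
  by rewrite mulVKg.
by rewrite !empty.
Qed.

Lemma T_opE x h : T_op R hpi x h =
  ((residue_card F)%:R^-1 * \1_(DC (repr x)) h)%:C%C.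
Proof.
by rewrite /T_op !indicE rmorphM fmorphV !rmorph_nat.
Qed.

(** The integrand is real, namely [q^-2] times an indicator. The imaginary part is kept as an
    integral of 0, identical for both orders of the factors. *)
Lemma convolution_T_opE x y g : convolution mu (T_op R hpi x) (T_op R hpi y) g =
  Complex (fine (((residue_card F)%:R^-1 ^+ 2)%:E *
                 mu (conv_support (repr x) (repr y) g)))
          (\int[mu]_h 0).
Proof.
rewrite /convolution /complex_integral; congr Complex; last first.
  by apply: eq_Rintegral => h _; rewrite !T_opE -rmorphM.
set S := conv_support _ _ _.
have mS : measurable S by exact: conv_support_measurable.
rewrite -[in RHS](setIT S) -(integral_indic mu measurableT mS).
(* The side condition concerns only a negative scalar, so it holds vacuously for [q^-2]. *)
rewrite -(integralZl_indic measurableT (fun=> S)) //; last first.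
  by rewrite ltNge exprn_ge0 ?invr_ge0 ?ler0n.
congr fine; apply: eq_integral => h _; rewrite !T_opE -rmorphM /=.
congr EFin; rewrite mulrACA -expr2; congr (_ * _).
rewrite !indicE -natrM mulnb; congr (_%:R).
apply: congr1; apply/idP/idP.
  by rewrite !in_setE => /andP[]; rewrite !in_setE.
by rewrite !in_setE => -[xh yh]; apply/andP; rewrite !in_setE.
Qed.

End Commutation.

Theorem corollary2p5 (R : realType) (F : nonArchLocalFieldType)
  (hF : 2%N \notin [pchar F])
  (pi : int_ring F) (hpi : generates_max_ideal pi)
  (mu : {measure set (borel_G_eps F) -> \bar R}) (hmu : is_Haar mu)
  (x y : residue_field F) :
  convolution mu (T_op R hpi x) (T_op R hpi y) =
  convolution mu (T_op R hpi y) (T_op R hpi x).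
Proof.
have [->//|nxy] := eqVneq x y.
apply/funext => g; rewrite !convolution_T_opE conv_support_comm //.
(* Lifts congruent modulo the maximal ideal have equal residue classes, so for distinct classes the
   lifts differ by a unit. *)
apply: contra nxy; rewrite Quotient.idealrBE => /eqP exy.
by rewrite -[x]reprK -[y]reprK; apply/eqP.
Qed.
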